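(* Let $\xi>0$ be real, $0<\theta<\frac{\pi}{5}$ and $u=e^{i\theta}$. Consider the equation $\frac{y^5+uy^4}{2}=\xi$ and the function $$f(\sigma)=\frac{\sin^4(\theta+4\sigma)\,\sin(\sigma-\theta)}{\sin^5(5\sigma)} .$$ Define the five disjoint intervals $$I_{-2}=\left[-\pi+\theta,-\tfrac{4\pi}{5}\right[,\quad I_{-1}=\left[-\tfrac{\pi}{2}-\tfrac{\theta}{4},-\tfrac{2\pi}{5}\right[,\quad I_0=\left[-\tfrac{\theta}{4},0\right[,\quad I_1=\left]\tfrac{2\pi}{5},\tfrac{\pi}{2}-\tfrac{\theta}{4}\right],\quad I_2=\left]\tfrac{4\pi}{5},\pi-\tfrac{\theta}{4}\right].$$ Then $f$ is continuous and strictly monotonic on each $I_k$, $k\in\{-2,-1,0,1,2\}$, and the equation $f(\sigma)=2\xi$ has a solution $\sigma_k$ in each $I_k$. Moreover the five roots of $\frac{y^5+uy^4}{2}=\xi$ are $$y^*_k=r_k e^{i\sigma_k},\qquad r_k=-\frac{\sin(\theta+4\sigma_k)}{\sin(5\sigma_k)}>0,\qquad k=-2,-1,0,1,2 .$$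
   Context: The notation $[a,b[$ (resp. $]a,b]$) denotes the half-open interval containing $a$ but not $b$ (resp. $b$ but not $a$). *)

(* Defs.v *)
From HB Require Import structures.
From mathcomp Require Import all_boot all_order all_algebra.
From mathcomp Require Import all_classical all_reals all_analysis.
From mathcomp Require Import complex.
Set Implicit Arguments.
Unset Strict Implicit.
Unset Printing Implicit Defensive.

Import Order.TTheory GRing.Theory Num.Theory.
Import numFieldNormedType.Exports.

Local Open Scope classical_set_scope.
Local Open Scope ring_scope.
Local Open Scope complex_scope.

(* e^(it), for t real *)
Definition expi (R : realType) (t : R) : R[i] := cos t +i* sin t.

(* The function f; it is only meaningful where sin (5 sigma) <> 0, since
   division by 0 yields 0. *)
Definition f (R : realType) (theta sigma : R) : R :=
  sin (theta + 4 * sigma) ^+ 4 * sin (sigma - theta) / sin (5 * sigma) ^+ 5.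

(* The modulus r_k attached to the angle sigma_k *)
Definition r (R : realType) (theta sigma : R) : R :=
  - (sin (theta + 4 * sigma) / sin (5 * sigma)).

Definition indices : seq int := [:: -2; -1; 0; 1; 2].

(* The interval I_k; the last branch is I_2, and values of k outside of
   [indices] are never used. *)
Definition I (R : realType) (theta : R) (k : int) : interval R :=
  if k == -2 then `[- pi + theta, - (4 * pi / 5)[
  else if k == -1 then `[- (pi / 2) - theta / 4, - (2 * pi / 5)[
  else if k == 0 then `[- (theta / 4), 0[
  else if k == 1 then `]2 * pi / 5, pi / 2 - theta / 4]
  else `]4 * pi / 5, pi - theta / 4].

Definition strictly_monotonic_on (R : realType) (J : interval R) (g : R -> R) :=
  {in J &, {homo g : x y / x < y}} \/ {in J &, {homo g : x y /~ x < y}}.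

(* Main.v *)
Require Import Defs.
From HB Require Import structures.
From mathcomp Require Import all_boot all_order all_algebra.
From mathcomp Require Import all_classical all_reals all_analysis.
From mathcomp Require Import complex.
From mathcomp Require Import ring lra.
Set Implicit Arguments.
Unset Strict Implicit.
Unset Printing Implicit Defensive.

Import Order.TTheory GRing.Theory Num.Theory.
Import numFieldNormedType.Exports.

Local Open Scope classical_set_scope.
Local Open Scope ring_scope.
Local Open Scope complex_scope.

(* Writing y = r e^(is), the imaginary part of y^5 + u y^4 = 2 xi forces
   r = - sin (theta + 4 s) / sin (5 s), and its real part then reads
   f s = 2 xi. With a = theta + 4 s and b = s - theta, so that 5 s = a + b,
   the derivative of f is sin a ^ 3 / sin (5 s) ^ 6 times a sum of two
   squares; hence f is monotonic wherever sin a keeps its sign, as it does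
   inside every I_k. On I_k, f runs from 0 at the closed end to infinity at
   the open one, so f = 2 xi has a solution there. The I_k are disjoint subsets
   of ]- pi, pi], so the five resulting roots are distinct, and a polynomial
   of degree 5 has no further root. *)

(** * Sign of the sine on half-periods, and injectivity of the angle *)

Lemma sinB2pi_int (R : realType) (k : int) (x : R) :
  sin (x - 2 * pi * k%:~R) = sin x.
Proof.
have sinDn n (y : R) : sin (y + 2 * pi * n%:R) = sin y.
  by rewrite -(periodicn (@sinD2pi R) n y); congr sin; rewrite -mulr_natr; ring.
case: k => n; first by rewrite -[LHS](sinDn n) subrK.
by rewrite NegzE mulrNz mulrN opprK sinDn.
Qed.

Lemma sin_gt0_int (R : realType) (k : int) (x : R) :
  2 * pi * k%:~R < x < 2 * pi * k%:~R + pi -> 0 < sin x.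
Proof.
move=> /andP[? ?]; rewrite -(sinB2pi_int k) sin_gt0_pi//.
by apply/andP; split; lra.
Qed.

Lemma sin_ge0_int (R : realType) (k : int) (x : R) :
  2 * pi * k%:~R <= x <= 2 * pi * k%:~R + pi -> 0 <= sin x.
Proof.
move=> /andP[? ?]; rewrite -(sinB2pi_int k) sin_ge0_pi//.
by apply/andP; split; lra.
Qed.

Lemma sin_lt0_int (R : realType) (k : int) (x : R) :
  2 * pi * k%:~R - pi < x < 2 * pi * k%:~R -> sin x < 0.
Proof.
move=> /andP[? ?]; rewrite -oppr_gt0 -sinN (@sin_gt0_int _ (- k))//.
by rewrite mulrNz; apply/andP; split; lra.
Qed.

Lemma sin_le0_int (R : realType) (k : int) (x : R) :
  2 * pi * k%:~R - pi <= x <= 2 * pi * k%:~R -> sin x <= 0.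
Proof.
move=> /andP[? ?]; rewrite -oppr_ge0 -sinN (@sin_ge0_int _ (- k))//.
by rewrite mulrNz; apply/andP; split; lra.
Qed.

(** Equal values give cos (x - y) = 1, hence sin ((x - y) / 2) = 0; as (x - y) / 2 lies in ]- pi,
    pi[, where the sine vanishes only at 0, x = y. *)
Lemma expi_inj (R : realType) :
  {in `]- pi, pi] &, injective (@expi R)}.
Proof.
move=> x y; rewrite !in_itv/= => /andP[? ?] /andP[? ?] [cosE sinE].
have h0 : sin ((x - y) / 2) = 0.
  have : cos (x - y) = 1.
    by rewrite cosB cosE sinE -!expr2 cos2Dsin2.
  have {1}-> : x - y = ((x - y) / 2) *+ 2 by rewrite -mulr_natr; field.
  rewrite cos_mulr2n => E; apply/eqP; rewrite -sqrf_eq0 sin2cos2; apply/eqP; lra.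
case: (ltgtP x y) => // xy.
- have : sin ((x - y) / 2) < 0.
    by apply: (@sin_lt0_int _ 0); apply/andP; split; lra.
  by rewrite h0 ltxx.
- have : 0 < sin ((x - y) / 2).
    by apply: (@sin_gt0_int _ 0); apply/andP; split; lra.
  by rewrite h0 ltxx.
Qed.

(** * The derivative of [f] and its sign *)

Lemma is_derive_sin_comp (R : realType) (g : R -> R) (s d : R) :
  is_derive s 1 g d -> is_derive s 1 (fun x => sin (g x)) (d * cos (g s)).
Proof.
move=> Dg; rewrite mulrC; exact: (is_derive1_comp (is_derive_sin _) Dg).
Qed.

(* The second factor is (4 cot a - cot b)^2 + 25 multiplied by
   (sin a * sin b)^2, the addition formula for cot having been used in
   f' / f = 16 cot a + cot b - 25 cot (a + b). *)
Lemma is_derive_f (R : realType) (theta s : R) : sin (5 * s) != 0 ->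
  let a := theta + 4 * s in let b := s - theta in
  is_derive s 1 (f theta) (sin a ^+ 3 *
    ((4 * cos a * sin b - sin a * cos b) ^+ 2 + (5 * sin a * sin b) ^+ 2)
    / sin (5 * s) ^+ 6).
Proof.
move=> s50 a b.
have Da : is_derive s 1 (fun x : R => sin (theta + 4 * x)) (4 * cos a).
  apply: (@is_derive_sin_comp _ (fun x => theta + 4 * x)).
  by apply: is_derive_eq; rewrite add0r mul1r /GRing.scale/= mulr1.
have Db : is_derive s 1 (fun x : R => sin (x - theta)) (1 * cos b).
  apply: (@is_derive_sin_comp _ (fun x => x - theta)).
  by apply: is_derive_eq; rewrite subr0.
have Dc : is_derive s 1 (fun x : R => sin (5 * x)) (5 * cos (5 * s)).
  apply: (@is_derive_sin_comp _ (fun x => 5 * x)).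
  by apply: is_derive_eq; rewrite /GRing.scale/= mulr1.
have Dv : is_derive s 1 (fun x : R => (sin (5 * x))^-1)
    (- sin (5 * s) ^- 2 *: (5 * cos (5 * s))).
  exact: is_deriveV.
(* A product of powers of functions lets the derivative be inferred from [Da], [Db] and [Dv]. *)
have -> : f theta = (fun x => sin (theta + 4 * x)) ^+ 4 *
    (fun x => sin (x - theta)) * (fun x => (sin (5 * x))^-1) ^+ 5.
  by apply/funext => x; rewrite /f -exprVn !fctE.
apply: is_derive_eq; rewrite !fctE /GRing.scale/= -/a -/b.
(* Once 5 s = a + b is expanded, the claim is a rational identity in the sines and cosines of a and
   b. *)
have e5 : 5 * s = a + b by rewrite /a /b; ring.
have {1}-> : cos (5 * s) = cos a * cos b - sin a * sin b by rewrite e5 cosD.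
have S5 : sin (5 * s) = sin a * cos b + cos a * sin b by rewrite e5 sinD.
rewrite S5 in s50 *.
by field.
Qed.

(** The second square is positive unless sin b = 0; then cos b is nonzero and the first square
    reduces to (sin a * cos b)^2. *)
Lemma derivative_factor_gt0 (R : realType) (a b : R) : sin a != 0 ->
  0 < (4 * cos a * sin b - sin a * cos b) ^+ 2 + (5 * sin a * sin b) ^+ 2.
Proof.
move=> sa0; have [sb0|sb0] := eqVneq (sin b) 0.
  have cb0 : cos b != 0.
    apply: contra_eq_neq (cos2Dsin2 b) => cb0.
    by rewrite sb0 cb0 expr0n addr0 eq_sym oner_eq0.
  rewrite sb0 !mulr0 sub0r expr0n addr0 sqrrN exprn_even_gt0//=.
  by rewrite mulf_neq0.
rewrite ltr_wpDl ?sqr_ge0// exprn_even_gt0//= !mulf_neq0//.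
Qed.

(** * Monotonicity and solvability on a single interval *)

Lemma IVT_sign_change (R : realType) (g : R -> R) (lo hi : R) : lo < hi ->
  continuous g -> g lo * g hi < 0 -> exists2 c, c \in `]lo, hi[ & g c = 0.
Proof.
move=> lohi cg gg.
have [c + gc] : exists2 c, c \in `[lo, hi] & g c = 0.
  apply: IVT; first exact: ltW.
    exact: continuous_subspaceT.
  rewrite ge_min le_max; case: (ltgtP (g lo) 0) => glo;
    last by move: gg; rewrite glo mul0r ltxx.
    by move: gg; rewrite nmulr_rlt0// => /ltW.
  by move: gg; rewrite pmulr_rlt0// => /ltW ->.
rewrite !in_itv/= => /andP[loc chi]; exists c => //.
rewrite in_itv/= !lt_neqAle loc chi !andbT.
(* A zero at an endpoint would annul the product of the end values. An interior zero serves
   whichever end of the branch is closed. *)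
apply/andP; split; apply: contraTneq gg => e.
  by rewrite e gc mul0r ltxx.
by rewrite -e gc mulr0 ltxx.
Qed.

(* [f theta s = 2 * xi] with its denominator cleared: unlike [f], this is
   continuous at the open endpoint of a branch, so the intermediate value
   theorem applies on the closed interval. *)
Definition f_gap (R : realType) (theta xi s : R) : R :=
  sin (theta + 4 * s) ^+ 4 * sin (s - theta) - 2 * xi * sin (5 * s) ^+ 5.

(** Here d is the closed end and c the open one: the first term of [f_gap] vanishes at d and the
    second at c. The surviving terms have opposite signs because sin (5 d) and sin (c - theta) agree
    in sign. *)
Lemma f_gap_sign_change (R : realType) (theta xi d c : R) : 0 < xi ->
  sin (theta + 4 * d) * sin (d - theta) = 0 -> sin (5 * c) = 0 ->
  sin (theta + 4 * c) != 0 -> 0 < sin (5 * d) * sin (c - theta) ->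
  f_gap theta xi d * f_gap theta xi c < 0.
Proof.
move=> xi0 fd0 sc0 ac0 sgn; rewrite /f_gap sc0 expr0n mulr0 subr0.
rewrite exprSr -mulrA fd0 mulr0 sub0r.
have -> : - (2 * xi * sin (5 * d) ^+ 5) *
      (sin (theta + 4 * c) ^+ 4 * sin (c - theta)) =
    - (2 * xi * sin (5 * d) ^+ 4 * sin (theta + 4 * c) ^+ 4 *
       (sin (5 * d) * sin (c - theta))).
  by ring.
have sd0 : sin (5 * d) != 0 by apply: contraTneq sgn => ->; rewrite mul0r ltxx.
rewrite oppr_lt0 mulr_gt0// mulr_gt0//; last by rewrite exprn_even_gt0.
by rewrite mulr_gt0//; [exact: mulr_gt0|rewrite exprn_even_gt0].
Qed.

(** The two booleans cover branches closed on either side. The sign of sin (theta + 4 s) is asked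
    only inside, since it may vanish at the closed end; continuity extends strict monotonicity
    there. *)
Lemma f_branch (R : realType) (theta xi lo hi : R) (slo shi : bool) :
  let J := Interval (BSide slo lo) (BSide shi hi) in
  lo < hi -> {in J, forall s, sin (5 * s) != 0} ->
  {in `]lo, hi[, forall s, 0 < sin (theta + 4 * s)} \/
  {in `]lo, hi[, forall s, sin (theta + 4 * s) < 0} ->
  f_gap theta xi lo * f_gap theta xi hi < 0 ->
  [/\ {in J, forall s, sin (5 * s) != 0},
      {within [set` J], continuous (f theta)},
      strictly_monotonic_on J (f theta)
    & exists2 s : R, s \in J & f theta s = 2 * xi].
Proof.
move=> J lohi s50 sgn gg.
have cf : {within [set` J], continuous (f theta)}.
  apply: continuous_in_subspaceT => s; rewrite inE/= => sJ.
  apply/differentiable_continuous/derivable1_diffP.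
  by have [] := is_derive_f theta (s50 s sJ).
have subJ : {subset `]lo, hi[ <= J}.
  by apply: subset_itv; rewrite bnd_simp.
split => //.
- have Df s : s \in `]lo, hi[ -> derivable (f theta) s 1.
    by move=> /subJ/s50/(is_derive_f theta)[].
  case: sgn => sgn;
    [left; apply: gtr0_derive1_lt|right; apply: ltr0_derive1_lt] => // s sI.
    rewrite derive1E; have [_ ->] := is_derive_f theta (s50 s (subJ _ sI)).
    rewrite pmulr_lgt0 ?invr_gt0 ?exprn_even_gt0//= ?s50 ?subJ//.
    by rewrite pmulr_lgt0 ?derivative_factor_gt0 ?gt_eqF ?sgn// exprn_gt0// sgn.
  rewrite derive1E; have [_ ->] := is_derive_f theta (s50 s (subJ _ sI)).
  rewrite pmulr_llt0 ?invr_gt0 ?exprn_even_gt0//= ?s50 ?subJ//.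
  by rewrite pmulr_llt0 ?derivative_factor_gt0 ?lt_eqF ?sgn// exprn_odd_lt0//= sgn.
have cg : continuous (f_gap theta xi).
  have csin (h : R -> R) : continuous h -> continuous (fun x => sin (h x)).
    by move=> ch x; apply: continuous_comp; [exact: ch|exact: continuous_sin].
  have clin (m : R) : continuous (fun x : R => m * x).
    by move=> x; apply: cvgM; [exact: cvg_cst|exact: cvg_id].
  have cX n (h : R -> R) : continuous h -> continuous (fun x => h x ^+ n).
    by move=> ch x; apply: (@continuous_comp _ _ _ h (fun y => y ^+ n));
      [exact: ch|exact: exprn_continuous].
  move=> x; apply: cvgB; apply: cvgM; first 1 last.
  - apply: (csin (fun x => x - theta)) => y.
    by apply: cvgB; [exact: cvg_id|exact: cvg_cst].
  - exact: cvg_cst.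
  - exact: (cX 5%N _ (csin _ (clin 5))).
  - apply: (cX 4%N _ (csin (fun x => theta + 4 * x) _)) => y.
    by apply: cvgD; [exact: cvg_cst|exact: clin].
have [s sI gs0] := IVT_sign_change lohi cg gg.
exists s; first exact: subJ.
have ne : sin (5 * s) != 0 by apply: s50; exact: subJ.
rewrite /f; move/eqP: gs0; rewrite /f_gap subr_eq0 => /eqP ->.
by rewrite mulfK// expf_neq0.
Qed.

(** * The five intervals and the behaviour of [f] on them *)

Lemma I_elim (R : realType) (theta : R) (P : int -> interval R -> Prop) :
  P (-2) `[- pi + theta, - (4 * pi / 5)[ ->
  P (-1) `[- (pi / 2) - theta / 4, - (2 * pi / 5)[ ->
  P 0 `[- (theta / 4), 0[ ->
  P 1 `]2 * pi / 5, pi / 2 - theta / 4] ->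
  P 2 `]4 * pi / 5, pi - theta / 4] ->
  {in indices, forall k, P k (I theta k)}.
Proof.
(* [P] abstracts the index together with its interval, so each case receives explicit endpoints,
   ready for [lra]. *)
move=> ? ? ? ? ? k; rewrite !inE.
by move=> /or4P[/eqP->|/eqP->|/eqP->|/orP[]/eqP->].
Qed.

Lemma I_sub_Npipi (R : realType) (theta : R) : 0 < theta < pi / 5 ->
  {in indices, forall k, {subset I theta k <= `]- pi, pi]}}.
Proof.
move=> /andP[? ?]; have ? := pi_gt0 R.
by apply: (@I_elim R theta (fun _ J => {subset J <= _})) => s;
  rewrite !in_itv/= => /andP[? ?]; apply/andP; split; lra.
Qed.

Lemma I_disjoint (R : realType) (theta s : R) : 0 < theta < pi / 5 ->
  {in indices &, forall k l, s \in I theta k -> s \in I theta l -> k = l}.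
Proof.
move=> /andP[? ?]; have ? := pi_gt0 R => k l kI lI; move: k kI.
(* The nested eliminations give 25 cases: the diagonal is trivial, the others have contradictory
   bounds. *)
apply: (@I_elim R theta (fun k J => s \in J -> _ -> k = l)); move: l lI;
  apply: (@I_elim R theta (fun l J => _ -> s \in J -> _ = l)) => //;
  by rewrite !in_itv/= => /andP[? ?] /andP[? ?]; exfalso; lra.
Qed.

(** The bound on sin (5 s) is strict because 5 s reaches 2 pi k only at the open end; the other is
    weak because theta + 4 s may reach 2 pi k at the closed end. *)
Lemma sin_signs_I (R : realType) (theta : R) : 0 < theta < pi / 5 ->
  {in indices, forall k, {in I theta k, forall s,
    if 0 < k then 0 < sin (5 * s) /\ sin (theta + 4 * s) <= 0
    else sin (5 * s) < 0 /\ 0 <= sin (theta + 4 * s)}}.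
Proof.
move=> /andP[? ?]; have ? := pi_gt0 R.
apply: (@I_elim R theta (fun k J => {in J, forall s,
    if 0 < k then 0 < sin (5 * s) /\ sin (theta + 4 * s) <= 0
    else sin (5 * s) < 0 /\ 0 <= sin (theta + 4 * s)})) => s;
  rewrite in_itv/= => /andP[? ?]; split.
(* The integer supplied is k itself: 5 s and theta + 4 s lie within pi of 2 pi k, on opposite
   sides. *)
- by apply: (@sin_lt0_int _ (-2)); apply/andP; split; lra.
- by apply: (@sin_ge0_int _ (-2)); apply/andP; split; lra.
- by apply: (@sin_lt0_int _ (-1)); apply/andP; split; lra.
- by apply: (@sin_ge0_int _ (-1)); apply/andP; split; lra.
- by apply: (@sin_lt0_int _ 0); apply/andP; split; lra.
- by apply: (@sin_ge0_int _ 0); apply/andP; split; lra.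
- by apply: (@sin_gt0_int _ 1); apply/andP; split; lra.
- by apply: (@sin_le0_int _ 1); apply/andP; split; lra.
- by apply: (@sin_gt0_int _ 2); apply/andP; split; lra.
- by apply: (@sin_le0_int _ 2); apply/andP; split; lra.
Qed.

Lemma sin_2pi_int (R : realType) (k : int) : sin (2 * pi * k%:~R : R) = 0.
Proof. by rewrite -(sinB2pi_int k) subrr sin0. Qed.

Lemma f_on_I (R : realType) (theta xi : R) : 0 < xi -> 0 < theta < pi / 5 ->
  {in indices, forall k : int,
    [/\ {in I theta k, forall s : R, sin (5 * s) != 0},
        {within [set` I theta k], continuous (f theta)},
        strictly_monotonic_on (I theta k) (f theta)
      & exists2 s : R, s \in I theta k & f theta s = 2 * xi]}.
Proof.
move=> xi0 th k kI.
have s50 : {in I theta k, forall s, sin (5 * s) != 0}.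
  move=> s sI; have := sin_signs_I th kI sI.
  by case: ifP => _ [? _]; [rewrite gt_eqF|rewrite lt_eqF].
move: k kI s50; have /andP[? ?] := th; have ? := pi_gt0 R.
apply: (@I_elim R theta (fun k J => {in J, forall s, sin (5 * s) != 0} ->
    [/\ {in J, forall s : R, sin (5 * s) != 0},
        {within [set` J], continuous (f theta)},
        strictly_monotonic_on J (f theta)
      & exists2 s : R, s \in J & f theta s = 2 * xi])) => s50.
- apply: f_branch => //; first by lra.
    left=> s; rewrite in_itv/= => /andP[? ?].
    by apply: (@sin_gt0_int _ (-2)); apply/andP; split; lra.
  apply: f_gap_sign_change => //.
  (* For k = -2 the factor vanishing at the closed end is sin (s - theta); in the other branches it
     is sin (theta + 4 s). *)
  + by rewrite addrK sinN sinpi oppr0 mulr0.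
  + by rewrite -(sin_2pi_int R (-2)); congr sin; field.
  + by rewrite gt_eqF//; apply: (@sin_gt0_int _ (-2)); apply/andP; split; lra.
  + by rewrite nmulr_rgt0;
      [apply: (@sin_lt0_int _ 0)|apply: (@sin_lt0_int _ (-2))];
      apply/andP; split; lra.
- apply: f_branch => //; first by lra.
    left=> s; rewrite in_itv/= => /andP[? ?].
    by apply: (@sin_gt0_int _ (-1)); apply/andP; split; lra.
  apply: f_gap_sign_change => //.
  + rewrite [X in X * _](_ : _ = 0) ?mul0r//.
    by rewrite -(sin_2pi_int R (-1)); congr sin; field.
  + by rewrite -(sin_2pi_int R (-1)); congr sin; field.
  + by rewrite gt_eqF//; apply: (@sin_gt0_int _ (-1)); apply/andP; split; lra.
  + by rewrite nmulr_rgt0;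
      [apply: (@sin_lt0_int _ 0)|apply: (@sin_lt0_int _ (-1))];
      apply/andP; split; lra.
- apply: f_branch => //; first by lra.
    left=> s; rewrite in_itv/= => /andP[? ?].
    by apply: (@sin_gt0_int _ 0); apply/andP; split; lra.
  apply: f_gap_sign_change => //.
  + by rewrite [theta + _](_ : _ = 0) ?sin0 ?mul0r//; field.
  + by rewrite mulr0 sin0.
  + by rewrite gt_eqF//; apply: (@sin_gt0_int _ 0); apply/andP; split; lra.
  + by rewrite nmulr_rgt0;
      [apply: (@sin_lt0_int _ 0)|apply: (@sin_lt0_int _ 0)];
      apply/andP; split; lra.
- apply: f_branch => //; first by lra.
    right=> s; rewrite in_itv/= => /andP[? ?].
    by apply: (@sin_lt0_int _ 1); apply/andP; split; lra.
  (* For positive k the closed end is on the right, so the factors are swapped to put it first. *)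
  rewrite mulrC; apply: f_gap_sign_change => //.
  + rewrite [X in X * _](_ : _ = 0) ?mul0r//.
    by rewrite -(sin_2pi_int R 1); congr sin; field.
  + by rewrite -(sin_2pi_int R 1); congr sin; field.
  + by rewrite lt_eqF//; apply: (@sin_lt0_int _ 1); apply/andP; split; lra.
  + by rewrite mulr_gt0//;
      [apply: (@sin_gt0_int _ 1)|apply: (@sin_gt0_int _ 0)];
      apply/andP; split; lra.
- apply: f_branch => //; first by lra.
    right=> s; rewrite in_itv/= => /andP[? ?].
    by apply: (@sin_lt0_int _ 2); apply/andP; split; lra.
  rewrite mulrC; apply: f_gap_sign_change => //.
  + rewrite [X in X * _](_ : _ = 0) ?mul0r//.
    by rewrite -(sin_2pi_int R 2); congr sin; field.
  + by rewrite -(sin_2pi_int R 2); congr sin; field.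
  + by rewrite lt_eqF//; apply: (@sin_lt0_int _ 2); apply/andP; split; lra.
  + by rewrite mulr_gt0//;
      [apply: (@sin_gt0_int _ 2)|apply: (@sin_gt0_int _ 0)];
      apply/andP; split; lra.
Qed.

(** * Polar form and the roots of the quintic *)

Lemma expiD (R : realType) (x y : R) : expi (x + y) = expi x * expi y.
Proof. by rewrite /expi cosD sinD; congr (_ +i* _); rewrite addrC. Qed.

Lemma expiX (R : realType) (x : R) (n : nat) : expi x ^+ n = expi (n%:R * x).
Proof.
elim: n => [|n IHn]; first by rewrite expr0 mul0r /expi cos0 sin0.
by rewrite exprS IHn -expiD -natr1 mulrDl mul1r addrC.
Qed.

Lemma norm_eq_expi (R : realType) (x y s t : R) : 0 < x -> 0 < y ->
  x%:C * expi s = y%:C * expi t -> x = y /\ expi s = expi t.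
Proof.
move=> x0 y0 e; have xy : x = y.
  move: e => [re im]; apply/eqP.
  rewrite -(eqrXn2 (n := 2))// ?ltW//; apply/eqP.
  (* The zeros are the imaginary part of [x%:C] in the unfolded product, so that [re] and [im]
     match. *)
  have -> : x ^+ 2 = (x * cos s - 0 * sin s) ^+ 2 + (x * sin s + 0 * cos s) ^+ 2.
    by rewrite -[LHS]mulr1 -(cos2Dsin2 s); ring.
  by rewrite re im -[RHS]mulr1 -(cos2Dsin2 t); ring.
split=> //; apply: (@mulfI _ x%:C); last by rewrite e xy.
by rewrite fmorph_eq0 gt_eqF.
Qed.

(** The value of [r] cancels the imaginary part; the real part is then the sine of the difference 5
    s - (theta + 4 s) = s - theta, over sin (5 s). *)
Lemma expi_branch_real (R : realType) (theta s : R) : sin (5 * s) != 0 ->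
  (r theta s)%:C * expi (5 * s) + expi (theta + 4 * s) =
  (sin (s - theta) / sin (5 * s))%:C.
Proof.
move=> s50.
have -> : s - theta = 5 * s - (theta + 4 * s) by ring.
rewrite sinB /r; apply/eqP; rewrite eq_complex; apply/andP; split; apply/eqP => /=;
  by field.
Qed.

Lemma branch_root (R : realType) (theta xi s : R) : sin (5 * s) != 0 ->
  f theta s = 2 * xi -> let y := (r theta s)%:C * expi s in
  (y ^+ 5 + expi theta * y ^+ 4) / 2 = xi%:C.
Proof.
move=> s50 fs y.
have -> : y ^+ 5 + expi theta * y ^+ 4 =
    (r theta s)%:C ^+ 4 * ((r theta s)%:C * expi (5 * s) + expi (theta + 4 * s)).
  rewrite /y !exprMn !expiX expiD exprS; ring.
rewrite expi_branch_real// -rmorphXn -rmorphM/=.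
have -> : r theta s ^+ 4 * (sin (s - theta) / sin (5 * s)) = 2 * xi.
  by rewrite -fs /f /r; field.
by rewrite rmorphM/= rmorph_nat mulrAC mulfV ?mul1r// pnatr_eq0.
Qed.

(** Otherwise [y :: ys] would list six distinct roots of a polynomial of degree 5. *)
Lemma quintic_root_mem (F : fieldType) (u c y : F) (ys : seq F) :
  size ys = 5%N -> uniq ys -> {in ys, forall z, z ^+ 5 + u * z ^+ 4 = c} ->
  y ^+ 5 + u * y ^+ 4 = c -> y \in ys.
Proof.
move=> sz uq ysP yP; apply/negPn/negP => yNys.
pose p : {poly F} := 'X^5 + (u *: 'X^4 - c%:P).
have szp : size p = 6%N.
  rewrite size_polyDl size_polyXn// (leq_ltn_trans (size_polyD _ _))// gtn_max.
  rewrite (leq_ltn_trans (size_scale_leq _ _)) ?size_polyXn//.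
  by rewrite size_polyN (leq_ltn_trans (size_polyC_leq1 _)).
have pE z : root p z = (z ^+ 5 + u * z ^+ 4 == c).
  by rewrite rootE !(hornerD, hornerN, hornerZ, hornerXn, hornerC) addrA subr_eq0.
have /(_ (y :: ys)) := @max_poly_roots _ p.
rewrite szp/= sz yNys uq pE yP eqxx/= ltnn => H; apply: (notF (H _ _ _)) => //.
  by rewrite -size_poly_gt0 szp.
by apply/allP => z /ysP e; rewrite pE e.
Qed.

Theorem mainTheorem5 (R : realType) (xi theta : R)
    (xi_gt0 : 0 < xi) (theta_gt0 : 0 < theta) (theta_lt : theta < pi / 5) :
  let u : R[i] := expi theta in
  [/\ {in indices &, forall k l : int, k != l ->
        [disjoint [set` I theta k] & [set` I theta l]]},
      {in indices, forall k : int,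
        [/\ {in I theta k, forall s : R, sin (5 * s) != 0},
            {within [set` I theta k], continuous (f theta)},
            strictly_monotonic_on (I theta k) (f theta)
          & exists2 s : R, s \in I theta k & f theta s = 2 * xi]}
    & forall sigma : int -> R,
      {in indices, forall k : int,
        sigma k \in I theta k /\ f theta (sigma k) = 2 * xi} ->
      let y_ (k : int) : R[i] := (r theta (sigma k))%:C * expi (sigma k) in
      [/\ {in indices, forall k : int, 0 < r theta (sigma k)},
          {in indices &, injective y_}
        & forall y : R[i], (y ^+ 5 + u * y ^+ 4) / 2 = xi%:C <->
            (exists2 k : int, k \in indices & y = y_ k)]].
Proof.
have th : 0 < theta < pi / 5 by rewrite theta_gt0.
move=> u; split.
- move=> k l kI lI; apply: contraNT => /set0P[s []]/=.
  by move=> sk sl; apply/eqP; exact: (I_disjoint th) sk sl.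
- exact: f_on_I.
move=> sigma sigmaP y_.
have s50 : {in indices, forall k, sin (5 * sigma k) != 0}.
  by move=> k kI; have [h _ _ _] := f_on_I xi_gt0 th kI; apply: h; case: (sigmaP k kI).
have r_gt0 : {in indices, forall k, 0 < r theta (sigma k)}.
  move=> k kI; have [sI fs] := sigmaP k kI.
  (* This upgrades the weak sign to a strict one: a zero here would give f = 0, against 2 xi > 0. *)
  have sa0 : sin (theta + 4 * sigma k) != 0.
    apply: contraTneq (mulr_gt0 (ltr0n R 2) xi_gt0) => sa0.
    by rewrite -fs /f sa0 expr0n !mul0r ltxx.
  rewrite /r oppr_gt0; have := sin_signs_I th kI sI.
  case: ifP => _ [s5 sa].
    by rewrite pmulr_llt0 ?invr_gt0// lt_neqAle sa0.
  by rewrite nmulr_llt0 ?invr_lt0// lt_neqAle eq_sym sa0.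
have y_inj : {in indices &, injective y_}.
  (* Equal roots have equal [expi], hence equal angles in ]- pi, pi], hence equal indices by
     disjointness. *)
  move=> k l kI lI /(norm_eq_expi (r_gt0 k kI) (r_gt0 l lI))[_].
  have [[sk _] [sl _]] := (sigmaP k kI, sigmaP l lI).
  move/(expi_inj (I_sub_Npipi th kI sk) (I_sub_Npipi th lI sl)) => e.
  by apply: (I_disjoint th kI lI sk); rewrite e.
have y_root : {in indices, forall k, (y_ k ^+ 5 + u * y_ k ^+ 4) / 2 = xi%:C}.
  by move=> k kI; apply: branch_root; [exact: s50|case: (sigmaP k kI)].
split=> // y; split=> [yP|[k kI ->]]; last exact: y_root.
have clear (z : R[i]) : (z ^+ 5 + u * z ^+ 4) / 2 = xi%:C ->
    z ^+ 5 + u * z ^+ 4 = xi%:C * 2.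
  by move=> <-; rewrite divfK// pnatr_eq0.
have /mapP[k kI ->] : y \in map y_ indices; last by exists k.
apply: (@quintic_root_mem _ u (xi%:C * 2)) => //; last exact: clear.
  by rewrite map_inj_in_uniq.
by move=> z /mapP[k kI ->]; apply: clear; exact: y_root.
Qed.
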